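(* The variety of lower wBCK*-semilattices is arithmetical, i.e. congruence distributive and congruence permutable.
   Context: A lower wBCK*-semilattice is an algebra $(A,\wedge,\to,1)$ where $(A,\wedge)$ is a meet-semilattice with order $\le$ and greatest element $1$, such that for all $x,y,z$: $x\le y$ iff $x\to y=1$, and if $x\le y\to z$ then $y\le x\to z$. (This class is equationally definable.) *)

(* Defs.v *)
From mathcomp Require Import all_boot.
From Corelib Require Import RelationClasses.
Set Implicit Arguments.
Unset Strict Implicit.
Unset Printing Implicit Defensive.

Record signature := Signature {
  opname : Type;
  arity : opname -> nat
}.

Record algebra (S : signature) := Algebra {
  carrier :> Type;
  op : forall f : opname S, (arity f).-tuple carrier -> carrier
}.

Definition compatible (S : signature) (A : algebra S) (R : A -> A -> Prop) : Prop :=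
  forall (f : opname S) (s t : (arity f).-tuple A),
    (forall i, R (tnth s i) (tnth t i)) -> R (op s) (op t).

Record congruence (S : signature) (A : algebra S) := Congruence {
  crel :> A -> A -> Prop;
  crel_equiv : Equivalence crel;
  crel_compat : compatible crel
}.

(* Con A, ordered by inclusion; equality of congruences is extensional. *)

Definition con_le (S : signature) (A : algebra S) (a b : congruence A) : Prop :=
  forall x y, a x y -> b x y.

Definition con_eq (S : signature) (A : algebra S) (a b : congruence A) : Prop :=
  forall x y, a x y <-> b x y.

Lemma con_meet_equiv (S : signature) (A : algebra S) (a b : congruence A) :
  Equivalence (fun x y => a x y /\ b x y).
Proof.
have [ra sa ta] := crel_equiv a; have [rb sb tb] := crel_equiv b.
split=> [x | x y [h k] | x y z [h k] [h' k']].
- by split; [exact: ra | exact: rb].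
- by split; [exact: sa | exact: sb].
- by split; [exact: ta h h' | exact: tb k k'].
Qed.

Lemma con_meet_compat (S : signature) (A : algebra S) (a b : congruence A) :
  compatible (fun x y => a x y /\ b x y).
Proof. by move=> f s t st; split; apply: crel_compat => i; case: (st i). Qed.

Definition con_meet (S : signature) (A : algebra S) (a b : congruence A)
  : congruence A := Congruence (con_meet_equiv a b) (@con_meet_compat S A a b).

(* The least congruence containing both a and b. *)
Definition join_rel (S : signature) (A : algebra S) (a b : congruence A)
  : A -> A -> Prop :=
  fun x y => forall c : congruence A, con_le a c -> con_le b c -> c x y.

Lemma con_join_equiv (S : signature) (A : algebra S) (a b : congruence A) :
  Equivalence (join_rel a b).
Proof.
split=> [x c _ _ | x y h c ac bc | x y z h k c ac bc];
  have [rc sc tc] := crel_equiv c; first exact: rc.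
- by apply: sc; apply: h.
- exact: tc (h c ac bc) (k c ac bc).
Qed.

Lemma con_join_compat (S : signature) (A : algebra S) (a b : congruence A) :
  compatible (join_rel a b).
Proof. by move=> f s t st c ac bc; apply: crel_compat => i; apply: st. Qed.

Definition con_join (S : signature) (A : algebra S) (a b : congruence A)
  : congruence A := Congruence (con_join_equiv a b) (@con_join_compat S A a b).

Lemma con_meet_glb (S : signature) (A : algebra S) (a b c : congruence A) :
  con_le c (con_meet a b) <-> con_le c a /\ con_le c b.
Proof.
split=> [h | [ca cb] x y cxy]; last by split; [exact: ca | exact: cb].
by split=> x y /h [].
Qed.

Lemma con_join_lub (S : signature) (A : algebra S) (a b c : congruence A) :
  con_le (con_join a b) c <-> con_le a c /\ con_le b c.
Proof.
split=> [h | [ac bc] x y]; last exact.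
by split=> x y xy; apply: h => d ad bd; [exact: ad | exact: bd].
Qed.

Definition rel_comp (T : Type) (R Q : T -> T -> Prop) : T -> T -> Prop :=
  fun x y => exists z, R x z /\ Q z y.

Definition has_permuting_congruences (S : signature) (A : algebra S) : Prop :=
  forall (a b : congruence A) x y, rel_comp a b x y <-> rel_comp b a x y.

Definition has_distributive_congruences (S : signature) (A : algebra S) : Prop :=
  forall a b c : congruence A,
    con_eq (con_meet a (con_join b c))
           (con_join (con_meet a b) (con_meet a c)).

Definition congruence_permutable (S : signature) (K : algebra S -> Prop) : Prop :=
  forall A, K A -> has_permuting_congruences A.

Definition congruence_distributive (S : signature) (K : algebra S -> Prop) : Prop :=
  forall A, K A -> has_distributive_congruences A.

Definition arithmetical (S : signature) (K : algebra S -> Prop) : Prop :=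
  congruence_distributive K /\ congruence_permutable K.

Inductive wBCK_op := Meet | Imp | One.

Definition wBCK_sig : signature :=
  Signature (fun f => match f with Meet => 2 | Imp => 2 | One => 0 end).

Definition meet (A : algebra wBCK_sig) (x y : A) : A :=
  op (a := A) (f := Meet) [tuple x; y].
Definition imp (A : algebra wBCK_sig) (x y : A) : A :=
  op (a := A) (f := Imp) [tuple x; y].
Definition one (A : algebra wBCK_sig) : A := op (a := A) (f := One) [tuple].
Definition le (A : algebra wBCK_sig) (x y : A) : Prop := meet x y = x.

Record lower_wBCKstar_semilattice (A : algebra wBCK_sig) : Prop := {
  meetA : forall x y z : A, meet x (meet y z) = meet (meet x y) z;
  meetC : forall x y : A, meet x y = meet y x;
  meetxx : forall x : A, meet x x = x;
  le_one : forall x : A, le x (one A);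
  le_imp : forall x y : A, le x y <-> imp x y = one A;
  imp_exch : forall x y z : A, le x (imp y z) -> le y (imp x z)
}.

(* Main.v *)
From mathcomp Require Import all_boot.
From Corelib Require Import RelationClasses.
Require Import Defs.
Set Implicit Arguments.
Unset Strict Implicit.
Unset Printing Implicit Defensive.

(**
  The term t(x,y,z) = ((x -> y) -> z) /\ ((z -> y) -> x) /\ ((x -> z) -> z) is a
  Pixley term: t(x,x,z) = z, t(x,z,z) = x and t(x,y,x) = x.  The first two
  meetands alone form a Mal'cev term; the third one equals x when z = x, while
  it lies above x and z and so does not disturb the Mal'cev identities.  If
  x a z b y, then w = t(x,z,y) satisfies x b w a y, so congruences permute and
  joins are relational products.  If x b z c y and x a y, then moreover
  w a t(x,z,x) = x, whence x (a /\ c) w (a /\ b) y, which gives distributivity.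
*)

Section Pixley.

Variables (S : signature) (A : algebra S) (p : A -> A -> A -> A).
Hypothesis p_compat : forall (c : congruence A) x x' y y' z z',
  c x x' -> c y y' -> c z z' -> c (p x y z) (p x' y' z').
Hypothesis pxxz : forall x z, p x x z = z.
Hypothesis pxzz : forall x z, p x z z = x.

Lemma crel_refl (c : congruence A) x : c x x.
Proof. by have [] := crel_equiv c. Qed.

Lemma crel_sym (c : congruence A) x y : c x y -> c y x.
Proof. by have [_ s _] := crel_equiv c; apply: s. Qed.

Lemma crel_trans (c : congruence A) x y z : c x y -> c y z -> c x z.
Proof. by have [_ _ t] := crel_equiv c; apply: t. Qed.

Lemma pixley_left (c : congruence A) x y z : c x z -> c (p x z y) y.
Proof.
by move=> xz; rewrite -[X in c _ X](pxxz z); apply: p_compat => //; exact: crel_refl.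
Qed.

Lemma pixley_right (c : congruence A) x y z : c z y -> c (p x z y) x.
Proof.
by move=> zy; rewrite -[X in c _ X](pxzz x y); apply: p_compat => //; exact: crel_refl.
Qed.

Lemma rel_comp_swap (a b : congruence A) x y :
  rel_comp a b x y -> rel_comp b a x y.
Proof.
case=> z [xz zy]; exists (p x z y); split; last exact: pixley_left.
exact/crel_sym/pixley_right.
Qed.

Lemma maltsev_permuting : has_permuting_congruences A.
Proof. by move=> a b x y; split; apply: rel_comp_swap. Qed.

(** Both symmetry and transitivity come from permutability: in a chain [x a u b y a v b z] the
    middle part [u b y a v] is swapped to [u a w b v], and the outer links are absorbed. *)
Lemma rel_comp_equiv (a b : congruence A) : Equivalence (rel_comp a b).
Proof.
split=> [x | x y [z [xz zy]] | x y z [u [xu uy]] [v [yv vz]]].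
- by exists x; split; exact: crel_refl.
- by apply: rel_comp_swap; exists z; split; exact: crel_sym.
- have [w [uw wv]] : rel_comp a b u v by apply: rel_comp_swap; exists y.
  by exists w; split; [exact: crel_trans uw | exact: crel_trans vz].
Qed.

Lemma rel_comp_compat (a b : congruence A) : compatible (rel_comp a b).
Proof.
(* Finite choice over the coordinates collects the intermediate elements into [u]; applying the
   operation to them gives the intermediate element for the results. *)
move=> f s t /fin_all_exists [u su_ut]; exists (op [tuple u i | i < arity f]).
by split; apply: crel_compat => i; rewrite tnth_mktuple; case: (su_ut i).
Qed.

(** The composite is itself a congruence above [a] and [b], so the least such congruence lies inside
    it. *)
Lemma con_join_comp (a b : congruence A) x y :
  con_join a b x y -> rel_comp a b x y.
Proof.
move=> /(_ (Congruence (rel_comp_equiv a b) (@rel_comp_compat a b))); apply.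
- by move=> u v uv; exists v; split=> //; exact: crel_refl.
- by move=> u v uv; exists u; split=> //; exact: crel_refl.
Qed.

Hypothesis pxyx : forall x y, p x y x = x.

Lemma pixley_distributive : has_distributive_congruences A.
Proof.
move=> a b c x y; split=> [[axy /con_join_comp [z [bxz czy]]] | ].
  have awx : a (p x z y) x.
    rewrite -[X in a _ X](pxyx x z).
    by apply: p_compat; [exact: crel_refl | exact: crel_refl | exact: crel_sym].
  move=> d abd acd; apply: (@crel_trans _ _ (p x z y)).
    by apply: acd; split; apply: crel_sym => //; exact: pixley_right.
  by apply: abd; split; [exact: crel_trans axy | exact: pixley_left].
(* This inclusion holds in every lattice. *)
move=> /(_ (con_meet a (con_join b c))); apply=> u v [auv h]; split=> //.
- by move=> d bd _; exact: bd.
- by move=> d _ cd; exact: cd.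
Qed.

End Pixley.

Section LowerWBCK.

Variable A : algebra wBCK_sig.

Lemma meet_compat (c : congruence A) x x' y y' :
  c x x' -> c y y' -> c (meet x y) (meet x' y').
Proof.
move=> xx' yy'; apply: (@crel_compat _ _ c Meet [tuple x; y] [tuple x'; y']) => i.
by rewrite !(tnth_nth x); case: i => [[|[|i]]].
Qed.

Lemma imp_compat (c : congruence A) x x' y y' :
  c x x' -> c y y' -> c (imp x y) (imp x' y').
Proof.
move=> xx' yy'; apply: (@crel_compat _ _ c Imp [tuple x; y] [tuple x'; y']) => i.
by rewrite !(tnth_nth x); case: i => [[|[|i]]].
Qed.

Definition pixley (x y z : A) : A :=
  meet (meet (imp (imp x y) z) (imp (imp z y) x)) (imp (imp x z) z).

Lemma pixley_compat (c : congruence A) x x' y y' z z' :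
  c x x' -> c y y' -> c z z' -> c (pixley x y z) (pixley x' y' z').
Proof. by move=> *; do ![apply: meet_compat | apply: imp_compat]. Qed.

Hypothesis hA : lower_wBCKstar_semilattice A.

Lemma impxx (x : A) : imp x x = one A.
Proof. by apply/(le_imp hA); exact: meetxx. Qed.

(** Exchange applied to reflexivity at [imp x y]. *)
Lemma le_impK (x y : A) : le x (imp (imp x y) y).
Proof. by apply: (imp_exch hA); exact: meetxx. Qed.

Lemma le_impr (x y : A) : le x (imp y x).
Proof. by apply: (imp_exch hA); rewrite impxx; exact: le_one. Qed.

Lemma imp1x (x : A) : imp (one A) x = x.
Proof.
have h : le (imp (one A) x) x.
  (* An element above [one A] equals it, so it suffices that [one A] lies below
     [imp (imp (one A) x) x], an instance of [le_impK]. *)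
  apply/(le_imp hA); rewrite -[LHS](le_one hA) (meetC hA).
  exact: le_impK.
by rewrite -h (meetC hA); exact: le_impr.
Qed.

Lemma pixley_xxz (x z : A) : pixley x x z = z.
Proof. by rewrite /pixley impxx imp1x le_impK le_impr. Qed.

Lemma pixley_xzz (x z : A) : pixley x z z = x.
Proof.
by rewrite /pixley impxx imp1x (meetC hA _ x) le_impK le_impK.
Qed.

Lemma pixley_xyx (x y : A) : pixley x y x = x.
Proof. by rewrite /pixley (meetxx hA) impxx imp1x (meetC hA) le_impr. Qed.

End LowerWBCK.

Theorem theorem5p4 : arithmetical lower_wBCKstar_semilattice.
Proof.
split=> A hA.
- exact: pixley_distributive (@pixley_compat A) (pixley_xxz hA) (pixley_xzz hA)
    (pixley_xyx hA).
- exact: maltsev_permuting (@pixley_compat A) (pixley_xxz hA) (pixley_xzz hA).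
Qed.
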